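(* A band $B$ is f-noetherian if and only if it is finite.
   Context: A right congruence on a semigroup $S$ is an equivalence relation $\rho$ on $S$ such that $(a,b)\in\rho$ implies $(as,bs)\in\rho$ for all $s\in S$. The right congruence generated by a set $X\subseteq S\times S$ is the smallest right congruence on $S$ containing $X$; a right congruence is finitely generated if it is generated by some finite set $X$. The index of an equivalence relation is the cardinality of its set of equivalence classes. A semigroup $S$ is f-noetherian if every right congruence of finite index on $S$ is finitely generated. A band is a semigroup in which every element is idempotent. *)

(* Defs.v *)
From Corelib Require Import RelationClasses.
From mathcomp Require Import all_boot.
From mathcomp Require Import boolp classical_sets functions cardinality.

Set Implicit Arguments.
Unset Strict Implicit.
Unset Printing Implicit Defensive.

Local Open Scope classical_set_scope.
Local Open Scope group_scope.

Definition right_congruence (S : semigroupType) (rho : set (S * S)) : Prop :=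
  Equivalence (fun a b => rho (a, b)) /\
  forall a b s : S, rho (a, b) -> rho (a * s, b * s).

Definition generated_right_congruence (S : semigroupType) (X : set (S * S)) :
    set (S * S) :=
  smallest (@right_congruence S) X.

Definition finitely_generated (S : semigroupType) (rho : set (S * S)) : Prop :=
  exists2 X : set (S * S),
    finite_set X & rho = generated_right_congruence X.

Definition eq_classes (T : Type) (rho : set (T * T)) : set (set T) :=
  range (fun a => [set b | rho (a, b)]).

Definition finite_index (T : Type) (rho : set (T * T)) : Prop :=
  finite_set (eq_classes rho).

Definition f_noetherian (S : semigroupType) : Prop :=
  forall rho : set (S * S),
    right_congruence rho -> finite_index rho -> finitely_generated rho.

Definition band (S : semigroupType) : Prop :=
  idempotent_op (fun x y : S => x * y).

(* Main.v *)
Require Import Defs.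
From mathcomp Require Import all_boot.
From mathcomp Require Import boolp classical_sets functions cardinality.

(** A finite semigroup has only finite right congruences, each generated by
    itself.  Conversely let [B] be an f-noetherian band, and preorder it by
    [a <= b] iff [a] lies in [BbB].  In a band [<=] is compatible with
    multiplication and [ab <= ba], so its equivalence J is a congruence with
    semilattice quotient, and every J-class is a rectangular band.  The proof
    has two halves.

    There are finitely many J-classes ([jrel_finite_index]).  Since right
    congruences of finite index are finitely generated, those of infinite
    index are closed under unions of chains; so if J had infinite index, Zorn
    would give a maximal right congruence [sigma] of infinite index containing
    J.  Over J the elements of [B] commute, so for each [b] both the kernel of
    [x |-> xb] and the Rees congruence collapsing the image [Bb] are right
    congruences containing [sigma].  By maximality [b] acts modulo [sigma] as
    the identity or as a constant.  Any two elements of the same kind are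
    [sigma]-related, so [sigma] has at most two classes: a contradiction.

    Every upper set [{x | a <= x}] is finite ([upper_set_finite]).  By
    induction on the number of J-classes above [a], the set F of elements
    strictly above [a] is finite.  Let D be the J-class of [a] and I the
    complement of the upper set, a prime ideal.  The congruence with classes
    D, I and the singletons of F has finite index, hence finitely many
    generators.  Coordinatize the rectangular band D by [x = (xa)(ax)].
    Right multiplication within the upper set does not move [xa]; on [ax] the
    finitely many elements of F act, whereas multiplying by an element of D
    makes it independent of [x].  So finitely many generators can only
    identify finitely many values of each coordinate, while all of D is one
    class: both coordinates take finitely many values and D is finite
    ([jclass_finite]).

    Finally [B] is the union of the upper sets of representatives of the
    finitely many J-classes. *)

Section Bands.
Set Implicit Arguments.
Unset Strict Implicit.
Local Open Scope classical_set_scope.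
Local Open Scope group_scope.

Lemma count_lt (T : eqType) (p q : pred T) (s : seq T) (x : T) :
  subpred p q -> x \in s -> q x -> ~~ p x -> (count p s < count q s)%N.
Proof.
move=> pq xs qx npx; rewrite (permP (perm_to_rem xs) p)
  (permP (perm_to_rem xs) q).
by rewrite /= qx (negPf npx) add0n add1n ltnS sub_count.
Qed.

Variable B : semigroupType.
Implicit Types (a b x y s : B) (rho sigma tau X : set (B * B)).

(** * Right congruences and their index *)

Lemma rc_refl rho a : right_congruence rho -> rho (a, a).
Proof. by case=> -[r _ _] _; apply: (r a). Qed.

Lemma rc_sym rho a b : right_congruence rho -> rho (a, b) -> rho (b, a).
Proof. by case=> -[_ sy _] _; apply: (sy a b). Qed.

Lemma rc_trans rho a b x :
  right_congruence rho -> rho (a, b) -> rho (b, x) -> rho (a, x).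
Proof. by case=> -[_ _ t] _; apply: (t a b x). Qed.

Lemma rc_mul rho a b s :
  right_congruence rho -> rho (a, b) -> rho (a * s, b * s).
Proof. by case=> _; apply. Qed.

Lemma rc_intro rho :
  (forall a, rho (a, a)) -> (forall a b, rho (a, b) -> rho (b, a)) ->
  (forall a b x, rho (a, b) -> rho (b, x) -> rho (a, x)) ->
  (forall a b s, rho (a, b) -> rho (a * s, b * s)) -> right_congruence rho.
Proof.
move=> r sy t m; split; last exact: m.
by constructor; [exact: r | exact: sy | exact: t].
Qed.

Lemma finite_index_reps rho : right_congruence rho ->
  finite_index rho <->
  exists2 R : set B, finite_set R & forall a, exists2 r, R r & rho (a, r).
Proof.
move=> rc; split=> [fin|[R fR hR]].
- have [[a0 _]|noB] := pselect (exists a0 : B, True); last first.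
    by exists set0 => // a; case: noB; exists a.
  exists [set xget a0 C | C in eq_classes rho]; first exact: finite_image.
  move=> a; exists (xget a0 [set b | rho (a, b)]).
    by exists [set b | rho (a, b)] => //; exists a.
  by apply: (@xgetPex _ a0 [set b | rho (a, b)]); exists a; apply: rc_refl.
- apply: (@sub_finite_set _ _ [set [set b | rho (r, b)] | r in R]); last first.
    exact: finite_image.
  move=> _ [a _ <-]; have [r Rr ar] := hR a; exists r => //.
  apply/seteqP; split=> b /= h; first exact: rc_trans ar h.
  by apply: rc_trans h => //; apply: rc_sym.
Qed.

(** The compactness step behind Zorn: it puts a finite generating set of the
    union of a chain into one member. *)
Lemma chain_finite_subset (F : set (set (B * B))) X :
  total_on F subset -> F !=set0 -> finite_set X ->
  X `<=` \bigcup_(C in F) C -> exists2 C, F C & X `<=` C.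
Proof.
move=> tot [C0 FC0] /finite_seqP[s ->].
elim: s => [|p s IHs] sub; first by exists C0.
have [|C FC sC] := IHs.
  by move=> q qs; apply: sub; rewrite /= inE; apply/orP; right.
have [|D FD Dp] := sub p; first by rewrite /= inE eqxx.
have [CD|DC] := tot _ _ FC FD.
- exists D => // q /=; rewrite inE => /orP[/eqP->//|qs].
  by apply: CD; apply: sC.
- exists C => // q /=; rewrite inE => /orP[/eqP->|]; last exact: sC.
  exact: DC.
Qed.

(** If the union of a chain of right congruences of infinite index had finite
    index, it would be finitely generated, hence equal to a member of the
    chain. *)
Lemma maximal_infinite_index rho : f_noetherian B ->
  right_congruence rho -> ~ finite_index rho ->
  exists sigma, [/\ right_congruence sigma, rho `<=` sigma,
    ~ finite_index sigma &
    forall tau, right_congruence tau -> sigma `<=` tau ->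
      ~ finite_index tau -> tau `<=` sigma].
Proof.
move=> noeth rcrho infrho.
pose Q sigma := [/\ right_congruence sigma, rho `<=` sigma &
  ~ finite_index sigma].
(* The empty chain has union [set0], which is therefore admitted among the
   candidates; it is not maximal because [rho], nonempty as it has infinite
   index, lies strictly above it. *)
have [|sigma [Psigma maxsigma]] :=
    @Zorn_bigcup _ (fun sigma => sigma = set0 \/ Q sigma).
  move=> F FP tot.
  have [[C0 [FC0 [p0 C0p0]]]|none] :=
      pselect (exists C, F C /\ C !=set0); last first.
    left; rewrite -subset0 => p [C FC Cp]; case: none; exists C.
    by split=> //; exists p.
  have FQ C p : F C -> C p -> Q C.
    by move=> FC Cp; case: (FP C FC) => // C0'; rewrite C0' in Cp.
  right; have [rcC0 rhoC0 _] := FQ _ _ FC0 C0p0.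
  have rcU : right_congruence (\bigcup_(C in F) C).
    apply: rc_intro.
    - by move=> a; exists C0 => //; apply: rc_refl.
    - move=> a b [C FC Cab]; exists C => //.
      by apply: rc_sym => //; case: (FQ _ _ FC Cab).
    - move=> a b x [C FC Cab] [D FD Dbx].
      have [rcC _ _] := FQ _ _ FC Cab; have [rcD _ _] := FQ _ _ FD Dbx.
      have [CD|DC] := tot _ _ FC FD.
      + by exists D => //; apply: rc_trans Dbx => //; apply: CD.
      + by exists C => //; apply: (rc_trans rcC Cab); apply: DC.
    - move=> a b s [C FC Cab]; exists C => //.
      by apply: rc_mul => //; case: (FQ _ _ FC Cab).
  split=> //; first by move=> p rp; exists C0 => //; apply: rhoC0.
  move=> finU; have [X finX UX] := noeth _ rcU finU.
  have [|C FC XC] := chain_finite_subset tot (ex_intro _ C0 FC0) finX.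
    by rewrite UX; apply: sub_smallest.
  case: (FP C FC) => [Ce|[rcC _ infC]]; last first.
    apply: infC; suff <- : \bigcup_(C in F) C = C by [].
    apply/seteqP; split; last by move=> p Cp; exists C.
    by rewrite UX; apply: smallest_sub.
  have [_ _ infC0] := FQ _ _ FC0 C0p0; apply: infC0.
  suff <- : \bigcup_(C in F) C = C0 by [].
  apply/seteqP; split; last by move=> p Cp; exists C0.
  by rewrite UX; apply: smallest_sub => //; rewrite Ce in XC => p /XC.
have Qsigma : Q sigma.
  case: Psigma => // sigma0; exfalso.
  apply: (maxsigma rho); last by right; split.
  rewrite sigma0; split=> // sub.
  have Bempty (a : B) : False := sub (a, a) (rc_refl a rcrho).
  apply: infrho; apply/(finite_index_reps rcrho).
  by exists set0 => // a; case: (Bempty a).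
have [rcs rhos infs] := Qsigma; exists sigma; split=> // tau rct st inft.
apply: contrapT => nts; apply: (maxsigma tau); first by split.
by right; split=> //; apply: subset_trans st.
Qed.

(** * The J-order of a band *)

Hypothesis bandB : band B.

Lemma bandK x : x * x = x. Proof. exact: bandB. Qed.

(** The J-order.  The ideal [BbB] is already the principal ideal of [b], since
    [b = b * b * b]. *)
Definition jle a b := exists u v, a = u * b * v.

Lemma jle_refl a : jle a a.
Proof. by exists a, a; rewrite !bandK. Qed.

Lemma jle_trans a b x : jle a b -> jle b x -> jle a x.
Proof.
by move=> [u [v ->]] [u' [v' ->]]; exists (u * u'), (v' * v); rewrite !mulgA.
Qed.

Lemma jle_mulr a s : jle (a * s) a.
Proof. by exists a, s; rewrite bandK. Qed.

Lemma jle_mull a s : jle (s * a) a.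
Proof. by exists s, a; rewrite -mulgA bandK. Qed.

Lemma jleC a b : jle (a * b) (b * a).
Proof. by exists a, b; rewrite -{1}(bandK (a * b)) !mulgA. Qed.

(** If [a = p b q = r x t] then [a = a a = r (x (t p b)) q], which puts [a]
    below [x (t p b)], and this is below [(t p b) x <= b x] by [jleC].  Hence
    products are meets for the J-order. *)
Lemma jle_meet a b x : jle a b -> jle a x -> jle a (b * x).
Proof.
move=> [p [q a1]] [r [t a2]].
have /jle_trans : jle a (x * ((t * p) * b)).
  by exists r, q; rewrite -{1}(bandK a) {1}a2 {1}a1 !mulgA.
apply; apply: jle_trans (jleC _ _) _.
by rewrite -mulgA; apply: jle_mull.
Qed.

(** Below [y] also means below [x y], say [x = p (x y) q]; as [y q] is
    idempotent, [x (y q) = x], and then [x y x = (x y)(x y) q = x].  Applied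
    within a J-class this is the rectangular band law. *)
Lemma jle_absorb x y : jle x y -> x * y * x = x.
Proof.
move=> xy; have [p [q xE]] := jle_meet (jle_refl x) xy.
have pxyq : p * (x * (y * q)) = x by rewrite {2}xE !mulgA.
have xyq : x * (y * q) = x.
  by rewrite -{1}pxyq -!mulgA [y * (q * (y * q))]mulgA bandK.
by rewrite -{2}xyq !mulgA -(mulgA (x * y)) bandK -mulgA.
Qed.

Definition jrel : set (B * B) := [set p | jle p.1 p.2 /\ jle p.2 p.1].

Lemma jle_mul2r a b s : jle a b -> jle (a * s) (b * s).
Proof.
move=> ab; apply: jle_meet (jle_mull _ _).
by apply: jle_trans ab; apply: jle_mulr.
Qed.

Lemma jle_mul2l a b s : jle a b -> jle (s * a) (s * b).
Proof.
move=> ab; apply: jle_meet (jle_mulr _ _) _.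
by apply: jle_trans ab; apply: jle_mull.
Qed.

Lemma jrel_right_congruence : right_congruence jrel.
Proof.
apply: rc_intro.
- by move=> a; split; apply: jle_refl.
- by move=> a b [].
- by move=> a b x [/= ab ba] [/= bx xb]; split;
    [apply: jle_trans ab bx|apply: jle_trans xb ba].
- by move=> a b s [/= ab ba]; split; apply: jle_mul2r.
Qed.

(** Modulo J right translations commute. *)
Lemma jrel_swap x a b : jrel (x * a * b, x * b * a).
Proof. by rewrite -!mulgA; split; apply/jle_mul2l/jleC. Qed.

(** * A band has finitely many J-classes *)

Section OverSemilattice.
Variable sigma : set (B * B).
Hypothesis rcs : right_congruence sigma.
Hypothesis jsig : jrel `<=` sigma.
Hypothesis infs : ~ finite_index sigma.
Hypothesis maxs : forall tau, right_congruence tau -> sigma `<=` tau ->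
  ~ finite_index tau -> tau `<=` sigma.

Let sigma_swap x a b : sigma (x * a * b, x * b * a).
Proof. exact/jsig/jrel_swap. Qed.

Lemma translation_kernel b :
  right_congruence [set p : B * B | sigma (p.1 * b, p.2 * b)].
Proof.
apply: rc_intro => /=.
- by move=> a; apply: rc_refl.
- by move=> a c; apply: rc_sym.
- by move=> a c x; apply: rc_trans.
- move=> a c s h; apply: (rc_trans rcs (sigma_swap _ _ _)).
  by apply: rc_trans (sigma_swap _ _ _) => //; apply: rc_mul.
Qed.

(** Modulo [sigma] the left ideal [B b] is also a right ideal, because right
    translations commute; so it has a Rees congruence. *)
Lemma translation_collapse b (inJ := fun x => exists y, sigma (x, y * b)) :
  right_congruence [set p | sigma p \/ inJ p.1 /\ inJ p.2].
Proof.
have inJs x y : sigma (x, y) -> inJ y -> inJ x.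
  by move=> xy [z yz]; exists z; apply: rc_trans yz.
apply: rc_intro => /=.
- by move=> a; left; apply: rc_refl.
- by move=> a c [h|[h1 h2]]; [left; apply: rc_sym|right].
- move=> a c x [h|[h1 h2]] [k|[k1 k2]].
  + by left; apply: rc_trans k.
  + by right; split=> //; apply: inJs h _.
  + by right; split=> //; apply: inJs h2; apply: rc_sym.
  + by right.
- have inJm x s : inJ x -> inJ (x * s).
    move=> [y xy]; exists (y * s).
    by apply: rc_trans (sigma_swap _ _ _) => //; apply: rc_mul.
  by move=> a c s [h|[h1 h2]]; [left; apply: rc_mul|right; split; apply: inJm].
Qed.

(** If the kernel of [x |-> x b] is not [sigma], maximality gives it finite
    index, so [B b] meets finitely many [sigma]-classes.  Collapsing [B b] to
    a point then loses only finitely many classes, so the result still has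
    infinite index and, by maximality again, is [sigma]: the set [B b] already
    lay in one class. *)
Lemma translation_dichotomy b :
  (forall x, sigma (x * b, x)) \/ (forall x y, sigma (x * b, y * b)).
Proof.
have [fin|inf] := pselect (finite_index
    [set p : B * B | sigma (p.1 * b, p.2 * b)]); last first.
  left=> x; apply: (maxs (translation_kernel b) _ inf) => /=.
    by move=> [u v] /= h; apply: rc_mul.
  by rewrite -mulgA bandK; apply: rc_refl.
right; have [R finR hR] := (finite_index_reps (translation_kernel b)).1 fin.
have rct := translation_collapse b.
apply: contrapT => notconst; apply: infs; apply/(finite_index_reps rcs).
have [R' finR' hR'] : exists2 R' : set B, finite_set R' & forall a,
    exists2 r, R' r & sigma (a, r) \/
      (exists y, sigma (a, y * b)) /\ (exists y, sigma (r, y * b)).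
  apply: (finite_index_reps rct).1; apply: contrapT => inf.
  apply: notconst => x y; apply: (maxs rct _ inf); first by left.
  by right; split; [exists x|exists y]; apply: rc_refl.
exists (R' `|` [set r * b | r in R]).
  by rewrite finite_setU; split=> //; apply: finite_image.
move=> a; have [r R'r [ar|[[y ayb] _]]] := hR' a; first by exists r; first left.
have [r' Rr' yr'] := hR y; exists (r' * b); first by right; exists r'.
exact: (rc_trans rcs ayb yr').
Qed.

(** Two elements [c], [d] that both act as identities satisfy
    [c ~ c d ~ d c ~ d]; if both act as constants,
    [d = d d ~ c d ~ d c ~ c c = c].  So there are at most two classes. *)
Lemma no_maximal_over_jrel : False.
Proof.
apply: infs; apply/(finite_index_reps rcs).
have cover (P : set B) : (forall c d, P c -> P d -> sigma (c, d)) ->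
    exists2 R : set B, finite_set R &
      forall c, P c -> exists2 r, R r & sigma (c, r).
  move=> hP; have [[r Pr]|noP] := pselect (P !=set0).
    by exists [set r] => // c Pc; exists r => //; apply: hP.
  by exists set0 => // c Pc; case: noP; exists c.
have [c d cid did|R1 finR1 hR1] := cover (fun b => forall x, sigma (x * b, x)).
  apply: (rc_trans rcs (rc_sym rcs (did c))).
  by apply: rc_trans (cid d) => //; apply/jsig; split; apply: jleC.
have [c d cc dc|R2 finR2 hR2] :=
    cover (fun b => forall x y, sigma (x * b, y * b)).
  have := cc c d; rewrite bandK => h; apply: (rc_trans rcs h).
  have := dc c d; rewrite bandK => k; apply: rc_trans k => //.
  by apply/jsig; split; apply: jleC.
exists (R1 `|` R2); first by rewrite finite_setU.
move=> a; have [/hR1[r]|/hR2[r]] := translation_dichotomy a.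
  by exists r; first left.
by exists r; first right.
Qed.

End OverSemilattice.

Lemma jrel_finite_index : f_noetherian B -> finite_index jrel.
Proof.
move=> noeth; apply: contrapT => inf.
have [sigma [rcs js infs maxs]] :=
  maximal_infinite_index noeth jrel_right_congruence inf.
exact: (no_maximal_over_jrel rcs js infs maxs).
Qed.

(** * Upper sets are finite *)

Section UpperSet.
Variable a : B.
Let D := [set x | jle a x /\ jle x a].
Let F := [set x | jle a x /\ ~ jle x a].
Let I := [set x | ~ jle a x].

(** The complement [I] of the upper set of [a] is collapsed, the elements
    strictly above [a] are kept apart, and [E] is used on the J-class of [a].
    Taking [E] trivial gives the congruence to which f-noetherianity is
    applied; finer choices of [E] test what its generators can reach. *)
Definition block_relation (E : B -> B -> Prop) : set (B * B) :=
  [set p | [\/ p.1 = p.2, I p.1 /\ I p.2 | [/\ D p.1, D p.2 & E p.1 p.2]]].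

Let D_mul x s : D x -> jle a s -> D (x * s).
Proof.
move=> [ax xa] as_; split; first exact: jle_meet.
by apply: jle_trans xa; apply: jle_mulr.
Qed.

Let I_mul x s : I x -> I (x * s).
Proof. by move=> nx /jle_trans h; apply: nx; apply: h; apply: jle_mulr. Qed.

Let I_mull x s : I s -> I (x * s).
Proof. by move=> nx /jle_trans h; apply: nx; apply: h; apply: jle_mull. Qed.

Let D_I x : D x -> I x -> False. Proof. by move=> [ax _] /(_ ax). Qed.

Lemma block_relation_rc (E : B -> B -> Prop) :
  (forall x, E x x) -> (forall x y, E x y -> E y x) ->
  (forall x y z, E x y -> E y z -> E x z) ->
  (forall x y s, D x -> D y -> jle a s -> E x y -> E (x * s) (y * s)) ->
  right_congruence (block_relation E).
Proof.
move=> Er Es Et Em; apply: rc_intro; rewrite /block_relation /=.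
- by move=> x; constructor 1.
- move=> x y [->|[Ix Iy]|[Dx Dy /Es]]; first by constructor 1.
    by constructor 2.
  by constructor 3.
- move=> x y z [->//|[Ix Iy]|[Dx Dy Exy]] [<-|[Iy' Iz]|[Dy' Dz Eyz]].
  + by constructor 2.
  + by constructor 2.
  + by case: (D_I Dy').
  + by constructor 3.
  + by case: (D_I Dy).
  + by constructor 3; split=> //; apply: Et Eyz.
- move=> x y s [->|[Ix Iy]|[Dx Dy Exy]]; first by constructor 1.
    by constructor 2; split; apply: I_mul.
  have [as_|nas] := pselect (jle a s); last first.
    by constructor 2; split; apply: I_mull.
  by constructor 3; split; [apply: D_mul|apply: D_mul|apply: Em].
Qed.

Lemma block_relation_finite_index :
  finite_set F -> finite_index (block_relation (fun _ _ => True)).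
Proof.
move=> finF; apply/finite_index_reps; first exact: block_relation_rc.
have [[i Ii]|noI] := pselect (I !=set0).
- exists (i |` (a |` F)); first by rewrite !finite_setU.
  move=> x; have [ax|nax] := pselect (jle a x); last first.
    by exists i; [left|constructor 2].
  have [xa|nxa] := pselect (jle x a).
    exists a; first by right; left.
    by constructor 3; split=> //; split=> //; exact: jle_refl.
  by exists x; [right; right|constructor 1].
- exists (a |` F); first by rewrite !finite_setU.
  move=> x; have [ax|nax] := pselect (jle a x); last by case: noI; exists x.
  have [xa|nxa] := pselect (jle x a).
    exists a; first by left.
    by constructor 3; split=> //; split=> //; exact: jle_refl.
  by exists x; [right|constructor 1].
Qed.

Let Da : D a. Proof. by split; apply: jle_refl. Qed.

Let supp X := [set x | D x /\ exists y, X (x, y) \/ X (y, x)].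

(** [P] collects the values of the coordinate [g] that the generators [X] can
    identify with others.  When [P] is stable under the action, up to values
    of [g] that do not depend on the point acted upon, collapsing [P] to a
    point defines a right congruence; it contains [X], hence relates all of
    [D] to [a].  So [g] takes no value on [D] outside [P] other than [g a]. *)
Lemma finite_coordinate X (g : B -> B) (P : set B) :
  block_relation (fun _ _ => True) = generated_right_congruence X ->
  (forall x, supp X x -> P (g x)) ->
  (forall x y s, D x -> D y -> jle a s -> g x = g y -> g (x * s) = g (y * s)) ->
  (forall x s, D x -> jle a s -> P (g x) ->
     P (g (x * s)) \/ (forall y, D y -> g (y * s) = g (x * s))) ->
  finite_set P -> finite_set (g @` D).
Proof.
move=> XE suppP gm Pm finP.
pose E x y := g x = g y \/ P (g x) /\ P (g y).
have rcE : right_congruence (block_relation E).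
  apply: block_relation_rc.
  - by move=> x; left.
  - by move=> x y [|[]]; [left|right].
  - move=> x y z [xy|[Px Py]] [yz|[Py' Pz]].
    + by left; rewrite xy.
    + by right; rewrite xy.
    + by right; rewrite -yz.
    + by right.
  - move=> x y s Dx Dy as_ [xy|[Px Py]]; first by left; apply: gm.
    have [Pxs|h] := Pm x s Dx as_ Px; last by left; rewrite h.
    have [Pys|h] := Pm y s Dy as_ Py; last by left; rewrite h.
    by right.
have XsubE : X `<=` block_relation E.
  move=> [x y] Xxy; have : block_relation (fun _ _ => True) (x, y).
    by rewrite XE; apply: sub_gen_smallest.
  move=> [h|h|[Dx Dy _]]; [by constructor 1|by constructor 2|].
  constructor 3; split=> //; right.
  by split; apply: suppP; split=> //; [exists y; left|exists x; right].
apply: (@sub_finite_set _ _ (g a |` P)); last by rewrite finite_setU.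
move=> _ [x Dx <-].
have : block_relation E (x, a).
  apply: (smallest_sub rcE XsubE); rewrite -/(generated_right_congruence X) -XE.
  by constructor 3.
by case=> [/= ->|[Ix _]|[_ _ [->|[Px _]]]]; [left|case: (D_I Dx)|left|right].
Qed.

Let rect x d : D x -> D d -> x * d * x = x.
Proof.
by move=> [ax xa] [ad da]; apply: jle_absorb; apply: jle_trans ad.
Qed.

Let rect3 x d y : D x -> D d -> D y -> x * d * y = x * y.
Proof.
move=> Dx Dd Dy; have [ay _] := Dy; have [ad _] := Dd.
rewrite -{1}(rect Dy Dx) !mulgA.
by rewrite -(mulgA x d) (rect Dx (D_mul Dd ay)).
Qed.

Let D_mull x s : D x -> jle a s -> D (s * x).
Proof.
move=> [ax xa] as_; split; first exact: jle_meet.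
by apply: jle_trans xa; apply: jle_mull.
Qed.

(** For [x |-> x a] the values at the generators suffice, as multiplying [x]
    on the right by an element above [a] does not change [x a].  For
    [x |-> a x] they have to be translated by [F]; a product [s t] of elements
    of [F] may fall into [D], where [a q (s t) = a s t] for every [q] above
    [a], so the products [a F F] are included to close the set. *)
Lemma jclass_finite : f_noetherian B -> finite_set F -> finite_set D.
Proof.
move=> noeth finF.
have [X finX XE] := noeth _ (block_relation_rc (fun=> Logic.I)
  (fun _ _ _ => Logic.I) (fun _ _ _ _ _ => Logic.I)
  (fun _ _ _ _ _ _ _ => Logic.I))
  (block_relation_finite_index finF).
have finQ : finite_set (supp X).
  apply: (@sub_finite_set _ _ (fst @` X `|` snd @` X)); last first.
    by rewrite finite_setU; split; apply: finite_image.
  by move=> x [_ [y [h|h]]]; [left; exists (x, y)|right; exists (y, x)].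
have finL : finite_set [set x * a | x in D].
  have eqL x s : D x -> jle a s -> x * s * a = x * a.
    move=> Dx as_; rewrite -(rect3 Dx (D_mull Da as_) Da).
    by rewrite -!mulgA bandK.
  apply: (finite_coordinate XE (P := [set x * a | x in supp X])).
  - by move=> x; exists x.
  - by move=> x y s Dx Dy as_; rewrite !eqL.
  - by move=> x s Dx as_ Px; left; rewrite eqL.
  - exact: finite_image.
have finR : finite_set [set a * x | x in D].
  apply: (finite_coordinate XE (P := [set a * q | q in supp X] `|`
    [set a * (q * s) | q in supp X `|` F & s in F])).
  - by move=> x; left; exists x.
  - by move=> x y s _ _ _ xy; rewrite !mulgA xy.
  - move=> x s Dx as_ Px; have [sa|nsa] := pselect (jle s a).
      by right=> y Dy; rewrite !mulgA !rect3.
    left; right; case: Px => [[q Qq qE]|[q Qq [t Ft tE]]].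
      by exists q; [left|exists s => //; rewrite !mulgA qE].
    have aq : jle a q by case: Qq => [[[]]|[]].
    have ats : jle a (t * s) by apply: jle_meet => //; case: Ft.
    have [tsa|ntsa] := pselect (jle (t * s) a); last first.
      exists q => //; exists (t * s) => //.
      by rewrite [RHS]mulgA -tE !mulgA.
    exists t; first by right.
    exists s => //; rewrite [RHS]mulgA -tE.
    (* [t s] has fallen into [D], so [q] may be dropped in front of it *)
    rewrite -(@rect3 a (a * q) (t * s)) ?mulgA ?bandK //.
    by apply: D_mul.
  - rewrite finite_setU; split; first exact: finite_image.
    by apply: finite_image2 => //; rewrite finite_setU.
apply: (@sub_finite_set _ _
  [set u * v | u in [set x * a | x in D] & v in [set a * x | x in D]]).
  move=> x Dx; exists (x * a); first by exists x.
  exists (a * x); first by exists x.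
  by rewrite mulgA -(mulgA x) bandK rect.
exact: finite_image2.
Qed.

End UpperSet.

(** Induction on the number of representatives of J-classes above [a]: it drops
    strictly from [a] to any [r] strictly above it. *)
Lemma upper_set_finite a : f_noetherian B -> finite_set [set x | jle a x].
Proof.
move=> noeth.
have [R /finite_seqP[s ->] hR] :=
  (finite_index_reps jrel_right_congruence).1 (jrel_finite_index noeth).
pose m b := count (fun r => `[< jle b r >]) s.
have [n] := ubnP (m a); elim: n a => // n IHn a ma.
have finF : finite_set [set x | jle a x /\ ~ jle x a].
  apply: (@sub_finite_set _ _
    (\bigcup_(r in [set` s] `&` [set r | jle a r /\ ~ jle r a])
       [set x | jle r x])).
    move=> x [ax nxa]; have [r sr [xr rx]] := hR x.
    exists r => //; split=> //; split; first exact: jle_trans ax xr.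
    by move=> ra; apply: nxa; apply: jle_trans ra.
  apply: bigcup_finite.
    by apply: finite_setIl; apply/finite_seqP; exists s.
  move=> r [_ [ar nra]]; apply: IHn.
  apply: (@leq_trans (m a)); last by rewrite -ltnS.
  have [r0 sr0 [ar0 r0a]] := hR a.
  apply: (@count_lt _ _ _ s r0) => //.
  - by move=> x /asboolP rx; apply/asboolP; apply: jle_trans rx.
  - exact/asboolP.
  - by apply/asboolP => rr0; apply: nra; apply: jle_trans rr0 r0a.
apply: (@sub_finite_set _ _
  ([set x | jle a x /\ ~ jle x a] `|` [set x | jle a x /\ jle x a])).
  by move=> x ax; have [xa|nxa] := pselect (jle x a); [right|left].
by rewrite finite_setU; split=> //; apply: jclass_finite.
Qed.

(** * Conclusion *)

Lemma f_noetherian_band_finite : f_noetherian B -> finite_set [set: B].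
Proof.
move=> noeth.
have [R finR hR] :=
  (finite_index_reps jrel_right_congruence).1 (jrel_finite_index noeth).
apply: (@sub_finite_set _ _ (\bigcup_(r in R) [set x | jle r x])).
  by move=> x _; have [r Rr [_ rx]] := hR x; exists r.
by apply: bigcup_finite => // r _; apply: upper_set_finite.
Qed.

End Bands.

Theorem corollary5p8 (B : semigroupType) (hB : band B) :
  f_noetherian B <-> finite_set [set: B]%classic.
Proof.
split=> [|finB rho rcrho _]; first exact: f_noetherian_band_finite.
exists rho; last by rewrite /generated_right_congruence smallest_id.
by apply: sub_finite_set (finite_setX finB finB) => p _.
Qed.
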